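(* (Fundamental Theorem of Calculus) Let $f:(a,b)\to\mathbb{R}$ be a differentiable function and $0<\alpha\le 1$. Then, for all $t>a$, $${}_{a}^{\rho}\mathcal{I}_{\gamma,\beta,\alpha}^{\delta,p,q}\Big({}_{i}^{\rho}\mathcal{V}_{\gamma,\beta,\alpha}^{\delta,p,q}f(t)\Big)=f(t)-f(a),$$ with $\gamma,\beta,\rho,\delta\in\mathbb{C}$ and $p,q>0$ such that $\mathrm{Re}(\gamma)>0$, $\mathrm{Re}(\beta)>0$, $\mathrm{Re}(\rho)>0$, $\mathrm{Re}(\delta)>0$ and $\mathrm{Re}(\gamma)+p\ge q$.
   Context: Here $(\rho)_{s}=\Gamma(\rho+s)/\Gamma(\rho)$ and $(\delta)_{s}=\Gamma(\delta+s)/\Gamma(\delta)$ are (generalized) Pochhammer symbols. The truncated function, with the index $i$ being the upper limit of summation, is $${}_{i}H_{\gamma,\beta,p}^{\rho,\delta,q}(z):=\Gamma(\beta)\sum_{k=0}^{i}\frac{(\rho)_{qk}}{(\delta)_{pk}}\frac{z^k}{\Gamma(\gamma k+\beta)}.$$ The truncated $\mathcal{V}$-fractional derivative of order $\alpha$ of a function $h$ is defined, for $t>0$, by $${}_{i}^{\rho}\mathcal{V}_{\gamma,\beta,\alpha}^{\delta,p,q}h(t):=\lim_{\epsilon\to 0}\frac{h\big(t\,{}_{i}H_{\gamma,\beta,p}^{\rho,\delta,q}(\epsilon t^{-\alpha})\big)-h(t)}{\epsilon}.$$ For $a\ge 0$, $t\ge a$ and a function $h$ defined on $(a,t]$, the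 $\mathcal{V}$-fractional integral of $h$ of order $\alpha$ is $${}_{a}^{\rho}\mathcal{I}_{\gamma,\beta,\alpha}^{\delta,p,q}h(t):=\frac{\Gamma(\gamma+\beta)(\delta)_p}{\Gamma(\beta)(\rho)_q}\int_a^t\frac{h(x)}{x^{1-\alpha}}\,dx.$$ These definitions are given for $0<\alpha<1$; the same formulas are meant when $\alpha=1$.
   Formalization: Added: i ≥ 1 (for i = 0 the V-derivative is identically 0); f(a) is the limit of f(x) as x→a+; the integral on the left exists as a Lebesgue integral; t < b; for complex parameters ε→0 runs over complex ε with t·H(εt^{-α}) real. *)

(* Defs.v *)
From HB Require Import structures.
From mathcomp Require Import all_boot all_order all_algebra.
From mathcomp Require Import complex.
From mathcomp Require Import all_classical all_reals all_analysis.

Set Implicit Arguments.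
Unset Strict Implicit.
Unset Printing Implicit Defensive.

Import Order.TTheory GRing.Theory Num.Theory.
Import numFieldNormedType.Exports.

Local Open Scope classical_set_scope.
Local Open Scope ring_scope.
Local Open Scope complex_scope.

Section ComplexIntegral.
Variable R : realType.
Local Notation mu := (@lebesgue_measure R).

Definition cintegrable (D : set R) (g : R -> R[i]) : Prop :=
  mu.-integrable D (fun x => (complex.Re (g x))%:E) /\
  mu.-integrable D (fun x => (complex.Im (g x))%:E).

Definition cintegral (D : set R) (g : R -> R[i]) : R[i] :=
  (\int[mu]_(x in D) complex.Re (g x)) +i*
  (\int[mu]_(x in D) complex.Im (g x)).

End ComplexIntegral.

Section Gamma.
Variable R : realType.

(* x ^ z = exp (z ln x), meaningful for x > 0 *)
Definition cpowR (x : R) (z : R[i]) : R[i] :=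
  (x `^ complex.Re z)%:C *
  (cos (complex.Im z * ln x) +i* sin (complex.Im z * ln x)).

(* Euler's integral, which defines the Gamma function on Re z > 0. *)
Definition cGamma (z : R[i]) : R[i] :=
  cintegral `]0, +oo[ (fun x => cpowR x (z - 1) * (expR (- x))%:C).

Definition pochhammer (z : R[i]) (s : R) : R[i] :=
  cGamma (z + s%:C) / cGamma z.

End Gamma.

Section VCalculus.
Variable R : realType.
Variables (rho delta gamma beta : R[i]) (p q : R).

Definition truncH (i : nat) (z : R[i]) : R[i] :=
  cGamma beta *
  \sum_(0 <= k < i.+1)
    pochhammer rho (q * k%:R) / pochhammer delta (p * k%:R) *
    (z ^+ k / cGamma (gamma * k%:R + beta)).

Definition Vpoint (i : nat) (alpha t : R) (e : R[i]) : R[i] :=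
  t%:C * truncH i (e * (t `^ (- alpha))%:C).

(* With complex parameters, t * H (e t^-alpha) is in general not a real number,
   while h is a function of a real variable.  As for any partially defined
   function, the limit is taken over the e <> 0 at which the difference
   quotient is defined, i.e. at which t * H (e t^-alpha) is real.  The increment
   e itself ranges over the complex numbers.  When the coefficients of H are
   real and the one of degree 1 is nonzero, w |-> H w is injective near 0 and
   commutes with conjugation, so such e are, near 0, exactly the real ones and
   this is the usual limit over real e.
   Only the values of h near t matter.  R[i] gets its topology from its norm
   through R[i]^o. *)
Definition Vderiv (i : nat) (alpha : R) (h : R -> R) (t : R) : R[i] :=
  lim (((h (complex.Re (Vpoint i alpha t e)) - h t)%:C / e : R[i]^o)
    @[e --> within [set e : R[i]^o | Vpoint i alpha t e \is Num.real]
              (0 : R[i]^o)^']).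

Definition Vintegrand (alpha : R) (h : R -> R[i]) (x : R) : R[i] :=
  h x / (x `^ (1 - alpha))%:C.

Definition Vintegral (alpha a : R) (h : R -> R[i]) (t : R) : R[i] :=
  cGamma (gamma + beta) * pochhammer delta p /
    (cGamma beta * pochhammer rho q) *
  cintegral `]a, t] (Vintegrand alpha h).

End VCalculus.

(* Main.v *)
(** The degree one coefficient c of H is nonzero because Gamma has no zero in the
    right half-plane.  Hence H - 1 is invertible near 0, the increments e at which
    t H(e t^-alpha) is real accumulate at 0, and the V-derivative of f at t is
    c t^(1-alpha) f'(t).  The integrand is therefore c f', and the prefactor of
    the integral is 1/c, so that the statement reduces to the fundamental theorem
    of calculus for an everywhere differentiable function whose derivative is
    merely Lebesgue integrable.

    That Gamma does not vanish follows from concentration: a zero z would propagate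
    to all the z + n by the functional equation, whereas
    s^(-i tau) Gamma(s + i tau) has positive real part for s large. *)

Require Import Defs.
From HB Require Import structures.
From mathcomp Require Import all_boot all_order all_algebra.
From mathcomp Require Import complex.
From mathcomp Require Import all_classical all_reals all_analysis.
From mathcomp Require Import measurable_realfun ring lra.

Import Order.TTheory GRing.Theory Num.Theory.
Import numFieldNormedType.Exports.

Local Open Scope classical_set_scope.
Local Open Scope ring_scope.
Local Open Scope complex_scope.

Set Implicit Arguments.
Unset Strict Implicit.
Unset Printing Implicit Defensive.

(** * Fundamental theorem of calculus for derivatives that are integrable *)

(** Take the supremum of the points [x] with [phi c <= phi x]. Comparison on its left puts it in
    this set, and comparison on its right then yields a larger element unless it equals [d]. *)
Lemma le_locally_nondecreasing (R : realType) (phi : R -> R) (c d : R) :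
    c <= d ->
    (forall x, c <= x <= d -> exists2 e : R, 0 < e &
       forall u w, c <= u -> w <= d -> x - e < u <= x -> x <= w < x + e ->
         phi u <= phi x <= phi w) ->
  phi c <= phi d.
Proof.
move=> cd loc; pose S := [set x | c <= x <= d /\ phi c <= phi x].
have Sc : S c by rewrite /S /= lexx cd.
have supS : has_sup S.
  by split; [exists c | exists d => x [/andP[]]].
have cs : c <= sup S by exact: ub_le_sup supS.2 c Sc.
have sd : sup S <= d by apply: ge_sup => [|x [/andP[]]//]; exists c.
have [e e0 he] := loc (sup S) (introT andP (conj cs sd)).
have [x Sx xs] := sup_adherent e0 supS.
have xleS : x <= sup S by exact: ub_le_sup supS.2 x Sx.
have cphis : phi c <= phi (sup S).
  case: Sx => /andP[cx _] /le_trans; apply.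
  have sse : sup S <= sup S < sup S + e by rewrite lexx ltrDl.
  by have /andP[] := he x (sup S) cx sd (introT andP (conj xs xleS)) sse.
have [sd'|sd'] := ltP (sup S) d; last by have <- : sup S = d by apply/le_anti/andP.
pose y := Num.min d (sup S + e / 2).
have sy : sup S < y by rewrite lt_min sd' /=; lra.
have yd : y <= d by rewrite ge_min lexx.
have yse : y <= sup S + e / 2 by rewrite ge_min lexx orbT.
have : S y.
  split; first by rewrite yd andbT; lra.
  apply: (le_trans cphis).
  have ess : sup S - e < sup S <= sup S by rewrite lexx andbT; lra.
  have sye : sup S <= y < sup S + e by rewrite (ltW sy)/=; lra.
  by have /andP[] := he (sup S) y cs yd ess sye.
by move=> /(ub_le_sup supS.2); rewrite leNgt sy.
Qed.

(** * Outer regularity and monotone majorants attached to null sets *)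

Section lebesgue_FTC.
Context {R : realType}.
Local Notation mu := (@lebesgue_measure R).

(** Absolute continuity of the integral of [v] reduces the claim to an open set of small measure
    around [M], which outer regularity provides since [M] is null. *)
Lemma open_cover_small_integral (v : R -> R) (M : set R) (e : R) :
    (forall x, 0 <= v x) -> mu.-integrable setT (EFin \o v) ->
    measurable M -> mu M = 0%E -> 0 < e ->
  exists U, [/\ open U, M `<=` U & (\int[mu]_(x in U) (v x)%:E <= e%:E)%E].
Proof.
move=> v0 iv mM muM e0.
have [d [d0 hd]] := integral_normr_continuous iv e0.
have [U [oU MU UM]] := lebesgue_regularity_outer mM (eq_ind_r (fun z => (z < +oo)%E) (ltry 0) muM) d0.
have mU : measurable U by exact: open_measurable.
exists U; split => //.
have muU : (mu U < d%:E)%E.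
  have UM0 : mu (U `&` M) = 0%E.
    by apply: (@subset_measure0 _ _ _ mu _ M) => //; exact: measurableI.
  by rewrite (measureDI mu mU mM) [X in (_ + X)%E]UM0 adde0.
have := hd U mU muU; rewrite /Rintegral.
under eq_integral do rewrite ger0_norm//.
have iU : (\int[mu]_(x in U) (v x)%:E)%E \is a fin_num.
  by apply: integrable_fin_num => //; apply: integrableS iv.
by rewrite -lte_fin fineK// => /ltW.
Qed.

(* W x is the sum over k of the integral of v over U_k and ]-oo, x], where the U_k
   are open neighbourhoods of M with rapidly decreasing integrals: W has small
   total variation but, relative to v, infinite slope at the points of M. *)
Lemma null_set_majorant (v : R -> R) (M : set R) (e : R) :
    (forall x, 0 <= v x) -> mu.-integrable setT (EFin \o v) ->
    measurable M -> mu M = 0%E -> 0 < e ->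
  exists W : R -> R, [/\ {homo W : x y / x <= y}, forall x, 0 <= W x <= e &
    forall x (K : nat), M x -> \forall r \near 0^'+, forall u w,
      x - r < u -> u <= w -> w < x + r ->
      K%:R * \int[mu]_(y in `]u, w]) v y <= W w - W u].
Proof.
move=> v0 iv mM muM e0.
(* The bounds [e / 2 ^ k.+1] sum to [e], which keeps [W] below [e]. *)
have ek k : 0 < e / (2 ^ k.+1)%:R by rewrite divr_gt0// ltr0n expn_gt0.
have /choice[U hU] := fun k => open_cover_small_integral v0 iv mM muM (ek k).
have oU k : open (U k) by have [] := hU k.
have MU k : M `<=` U k by have [] := hU k.
have mU k : measurable (U k) by exact: open_measurable.
have mv : measurable_fun setT v.
  by apply/measurable_EFinP; exact: measurable_int iv.
have v0' x : (0 <= (EFin \o v) x)%E by rewrite lee_fin.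
pose A k (D : interval R) := (\int[mu]_(y in U k `&` [set` D]) (v y)%:E)%E.
have A0 k D : (0 <= A k D)%E by apply: integral_ge0 => x _; exact: v0'.
have mUI k (D : interval R) : measurable (U k `&` [set` D]).
  by apply: measurableI; [exact: mU|exact: measurable_itv].
have AU k x y : x <= y -> (A k `]-oo, y] = A k `]-oo, x] + A k `]x, y])%E.
  move=> xy; rewrite /A.
  have -> : [set` `]-oo, y]] = [set` `]-oo, x]] `|` [set` `]x, y]].
    by rewrite -itv_bndbnd_setU.
  rewrite setIUr ge0_integral_setU//=;
    [| |by apply/measurable_EFinP; exact: measurable_funTS|
      by move=> z _; exact: v0' |]; do ?exact: mUI.
  apply/disj_set2P; rewrite -subset0 => z/= -[[_ +] [_ +]].
  by rewrite !in_itv/= => zx /andP[]; rewrite ltNge zx.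
pose W x := (\sum_(0 <= k <oo) A k `]-oo, x])%E.
have We x : (W x <= e%:E)%E.
  apply: le_trans (epsilon_trick0 xpredT (ltW e0)).
  apply: lee_nneseries => // k _; have [_ _] := hU k; apply: le_trans.
  apply: ge0_subset_integral => //; [exact: mUI|exact: mU| |].
    by apply/measurable_EFinP; exact: measurable_funTS.
  by move=> z _; exact: v0'.
have W0 x : (0 <= W x)%E by apply: nneseries_ge0 => *; exact: A0.
have Wfin x : W x \is a fin_num.
  by rewrite ge0_fin_numE// (le_lt_trans (We x))// ltry.
have WB x y : x <= y -> (W y = W x + \sum_(0 <= k <oo) A k `]x, y])%E.
  move=> xy; rewrite -nneseriesD//; apply: eq_eseriesr => k _; exact: AU.
exists (fine \o W); split.
- move=> x y xy /=; apply: fine_le => //; rewrite (WB _ _ xy) leeDl//.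
  by apply: nneseries_ge0 => *; exact: A0.
- by move=> x /=; rewrite fine_ge0//= -lee_fin fineK.
move=> x K Mx.
(* Near a point of [M] one ball lies in each of the first [K] open sets, so the first [K] terms in
   the increment of [W] are full integrals of [v] over []u, w]]. The remaining terms are
   nonnegative. *)
have : \forall r \near 0^'+, forall k, (k < K)%N -> ball x r `<=` U k.
  elim: K => [|K IH]; first by near=> r.
  have /nbhs_ballP[r /= r0 hr] := open_nbhs_nbhs (conj (oU K) (MU K x Mx)).
  near=> s => k; rewrite ltnS leq_eqVlt => /predU1P[->|].
    apply: subset_trans hr; apply: le_ball.
    by near: s; exact: nbhs_right_le.
  by move: k; near: s.
apply: filterS => r hr u w xu uw wx /=.
have uwU k : (k < K)%N -> `]u, w] `<=` U k.
  move=> kK; apply: subset_trans (hr _ kK) => z /=.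
  rewrite in_itv/= => /andP[uz zw]; rewrite /ball/= ltr_distlC.
  by rewrite (lt_trans xu uz) (le_lt_trans zw wx).
have iuw : mu.-integrable `]u, w] (EFin \o v) by exact: integrableS iv.
have -> : fine (W w) = fine (W u) + fine (\sum_(0 <= k <oo) A k `]u, w])%E.
  rewrite (WB _ _ uw) fineD//.
  have := Wfin w; rewrite (WB _ _ uw) fin_numD => /andP[]//.
rewrite addrAC subrr add0r -lee_fin fineK; last first.
  have := Wfin w; rewrite (WB _ _ uw) fin_numD => /andP[]//.
apply: le_trans (nneseries_lim_ge K _); last by move=> *; exact: A0.
rewrite [X in (_ <= X)%E](eq_big_nat _ _ (F2 := fun=> (\int[mu]_(y in `]u, w]) (v y)%:E)%E)); last first.
  by move=> k /andP[_ kK]; rewrite /A setIidr//; exact: uwU.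
under eq_bigr do rewrite -[(\int[mu]_(_ in _) _)%E]fineK ?integrable_fin_num//.
by rewrite sumEFin lee_fin sumr_const_nat subn0 mulr_natl.
Unshelve. all: end_near. Qed.
End lebesgue_FTC.

Lemma derivable_linear_approx (R : realType) (f : R -> R) (x e : R) :
    derivable f x 1 -> 0 < e ->
  \forall r \near 0^'+, forall y, x - r < y -> y < x + r ->
    `|f y - f x - derive1 f x * (y - x)| <= e * `|y - x|.
Proof.
move=> df e0; have {}df : h^-1 *: (f (h + x) - f x) @[h --> 0^'] --> derive1 f x.
  rewrite derive1E /derive; move: df; rewrite /derivable.
  by under eq_fun do rewrite /= [_ *: 1]mulr1.
move/cvgrPdist_le : df => /(_ e e0); rewrite near_withinE => /nbhs_ballP[r /= r0 hr].
near=> s => y xy yx.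
have [->|yx0] := eqVneq y x; first by rewrite !subrr mulr0 subr0 normr0 mulr0.
have yx1 : y - x != 0 by rewrite subr_eq0.
have sr : s < r by near: s; exact: nbhs_right_lt.
have /hr/(_ yx1) : ball 0 r (y - x).
  by rewrite /ball/= sub0r normrN ltr_norml; apply/andP; split; lra.
rewrite subrK /= => le_e.
rewrite -ler_pdivrMr ?normr_gt0// -normfV -normrM.
apply: le_trans le_e; rewrite le_eqVlt -normrN; apply/orP; left; apply/eqP; congr (`|_|).
rewrite /GRing.scale/=; field; exact: yx1.
Unshelve. all: end_near. Qed.

(** * One inequality of the fundamental theorem, on a compact interval *)

Section derivable_FTC.
Context {R : realType}.
Local Notation mu := (@lebesgue_measure R).

(* The primitive F of f' satisfies F' = f' off a null set N.  On N the growth of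
   the majorant W compensates the possible failure of differentiability of F, so
   that F + W + eta * id - f is locally nondecreasing at every point. *)
Lemma derivable_FTC_le (f : R -> R) (c d : R) : c < d ->
    (forall x, c <= x <= d -> derivable f x 1) ->
    mu.-integrable `[c, d] (EFin \o (derive1 f)) ->
  f d - f c <= \int[mu]_(x in `[c, d]) derive1 f x.
Proof.
move=> cd df ig; apply/ler_addgt0Pl => e e0.
(* The summand 1 makes the integral of [v] over []u, w]] control [w - u] as well as the integral of
   [|f'|]. *)
pose v := (fun x => `|derive1 f x| + 1) \_ `[c, d].
have v0 x : 0 <= v x by rewrite /v patchE; case: ifPn => // _; rewrite addr_ge0.
have iag : mu.-integrable `[c, d] (EFin \o (fun x => `|derive1 f x|)).
  exact: integrable_abse ig.
have i1 : mu.-integrable `[c, d] (EFin \o cst 1).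
  apply: continuous_compact_integrable; first exact: segment_compact.
  by apply: continuous_subspaceT => x; exact: cst_continuous.
have iv : mu.-integrable setT (EFin \o v).
  rewrite /v -restrict_EFin; apply/integrable_restrict => //=; rewrite setTI.
  exact: (integrableD _ iag i1).
pose g := (derive1 f) \_ `[c, d].
have igT : mu.-integrable setT (EFin \o g).
  by rewrite /g -restrict_EFin; apply/integrable_restrict => //=; rewrite setTI.
pose F x := \int[mu]_(y in `]-oo, x]) g y.
have FB u w : u <= w -> F w - F u = \int[mu]_(y in `]u, w]) g y.
  by move=> uw; rewrite /F Rintegral_itvB//; exact: integrableS igT.
have igy y : mu.-integrable `]-oo, y] (EFin \o g) by exact: integrableS igT.
have [N [mN muN hN]] := FTC1Ny igy (integrable_locally_restrict (measurable_itv _) ig).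
pose M := N `|` [set c] `|` [set d].
have mM : measurable M by apply: measurableU => //; apply: measurableU.
have muM : mu M = 0%E.
  apply: measure_negligible => //; apply: negligibleU; first apply: negligibleU.
  - exact/negligibleP.
  - by apply/negligibleP => //; exact: lebesgue_measure_set1.
  - by apply/negligibleP => //; exact: lebesgue_measure_set1.
have e2 : 0 < e / 2 by rewrite divr_gt0.
have [W [Wnd We Wbig]] := null_set_majorant v0 iv mM muM e2.
pose eta := e / 2 / (d - c).
have eta0 : 0 < eta by rewrite divr_gt0// subr_gt0.
pose phi x := F x + W x + eta * x - f x.
(* Over [[c, d]] both [W] and [eta * x] grow by at most [e / 2], so this comparison gives the
   inequality up to [e]. *)
suff : phi c <= phi d.
  have /andP[Wc0 _] := We c; have /andP[_ Wde] := We d.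
  have -> : \int[mu]_(x in `[c, d]) derive1 f x = F d - F c.
    rewrite FB ?ltW// Rintegral_itv_obnd_cbnd; last exact: integrableS igT.
    by apply: eq_Rintegral => x xcd; rewrite /g patchE xcd.
  have -> : e = e / 2 + eta * (d - c) by rewrite /eta divfK; [lra|rewrite subr_eq0 gt_eqF].
  rewrite /phi mulrBr; lra.
apply: le_locally_nondecreasing (ltW cd) _ => x xcd.
have [Mx|nMx] := pselect (M x).
(* At a point of [M], [W] grows by at least [K] times the integral of [|f'| + 1]. One unit of [K]
   pays for a decrease of [F], at most the integral of [|f'|]. The amount [|f' x| + 1] pays for the
   growth of [f] on either side of [x]. *)
- have [K hK] : exists K : nat, `|derive1 f x| + 2 <= K%:R.
    by exists (Num.truncn (`|derive1 f x| + 2)).+1; rewrite ltW// truncnS_gt.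
  have [r /= [r0 [hr Wr]]] : exists r : R, 0 < r /\
      ((forall y, x - r < y -> y < x + r ->
         `|f y - f x - derive1 f x * (y - x)| <= 1 * `|y - x|) /\
      (forall u w, x - r < u -> u <= w -> w < x + r ->
         K%:R * \int[mu]_(y in `]u, w]) v y <= W w - W u)).
    near (0 : R)^'+ => r; exists r; split; first by near: r; exact: nbhs_right_gt.
    split; near: r; first exact: derivable_linear_approx (df x xcd) ltr01.
    by apply: Wbig.
  have key u w : c <= u -> u <= w -> w <= d -> x - r < u -> w < x + r ->
      f w - f u <= (`|derive1 f x| + 1) * (w - u) -> phi u <= phi w.
    move=> cu uw wd xu wx fwu.
    have uwcd : `]u, w] `<=` `[c, d] by apply: subset_itv; rewrite bnd_simp.
    have iauw : mu.-integrable `]u, w] (EFin \o (fun x => `|derive1 f x|)).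
      exact: integrableS iag.
    have : - (\int[mu]_(y in `]u, w]) `|derive1 f y|) <= F w - F u.
      rewrite FB// lerNl (le_trans (ler_norm _))// normrN.
      apply: le_trans (le_normr_Rintegral _ _) _ => //; first exact: integrableS igT.
      rewrite le_eqVlt; apply/orP; left; apply/eqP; apply: eq_Rintegral => z zuw.
      by rewrite /g patchE mem_set//; apply: uwcd; rewrite inE in zuw.
    have := Wr u w xu uw wx.
    have -> : \int[mu]_(y in `]u, w]) v y = \int[mu]_(y in `]u, w]) `|derive1 f y| + (w - u).
      transitivity (\int[mu]_(y in `]u, w]) (`|derive1 f y| + cst 1 y)).
        apply: eq_Rintegral => z zuw.
        by rewrite /v patchE mem_set//; apply: uwcd; rewrite inE in zuw.
      rewrite RintegralD//; last by exact: integrableS i1.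
      congr (_ + _); rewrite (@Rintegral_cst _ _ _ mu)// mul1r.
      rewrite [X in fine X]lebesgue_measure_itv/= lte_fin.
      by case: ltP => //= wu; lra.
    have I0 : 0 <= \int[mu]_(y in `]u, w]) `|derive1 f y| by apply: Rintegral_ge0.
    have wu0 : 0 <= w - u by rewrite subr_ge0.
    have := ler_wpM2r (addr_ge0 I0 wu0) hK.
    have := mulr_ge0 (normr_ge0 (derive1 f x)) I0; move: I0.
    have : 0 <= eta * (w - u) by rewrite mulr_ge0 ?subr_ge0// ltW.
    move: fwu; rewrite /phi.
    set I := (\int[_]_(_ in _) _); set D := `|_|.
    lra.
  exists r => // u w cu wd /andP[xu ux] /andP[xw wx].
  have fx y : x - r < y -> y < x + r -> `|f y - f x| <= (`|derive1 f x| + 1) * `|y - x|.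
    move=> xy yx; rewrite -[leLHS]/(`|f y - f x|) -(subrK (derive1 f x * (y - x)) (f y - f x)).
    by rewrite (le_trans (ler_normD _ _))// normrM mulrDl addrC lerD2l hr.
  apply/andP; split; apply: key => //; rewrite ?(le_trans cu)// ?(le_trans _ wd)//; try lra.
    by have := fx u xu ltac:(lra); rewrite distrC (distrC u) (ger0_norm (_ : 0 <= x - u)) ?subr_ge0// => /(le_trans (ler_norm _)).
  by have := fx w ltac:(lra) wx; rewrite (ger0_norm (_ : 0 <= w - x)) ?subr_ge0// => /(le_trans (ler_norm _)).
- have cxd : c < x < d.
    move: xcd; rewrite !le_eqVlt => /andP[/orP[/eqP cx|->] /orP[/eqP xd|->]] //; exfalso; apply: nMx; rewrite /M.
    + by left; right; rewrite /= cx.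
    + by left; right; rewrite /= cx.
    + by right; rewrite /= xd.
  have [dF F'x] : derivable F x 1 /\ derive1 F x = derive1 f x.
    have nNx : ~ N x by move=> Nx; apply: nMx; left; left.
    have : derivable F x 1 /\ derive1 F x = g x by apply: contrapT => /(hN x).
    by rewrite {1}/g patchE mem_set.
  (* Off [M], [F] and [f] have the same derivative at [x]. Two errors of slope [eta / 2] are
     compensated by the term [eta * x], while [W] is nondecreasing. *)
  have [r /= [r0 [hf hF]]] : exists r : R, 0 < r /\
      ((forall y, x - r < y -> y < x + r ->
         `|f y - f x - derive1 f x * (y - x)| <= eta / 2 * `|y - x|) /\
      (forall y, x - r < y -> y < x + r ->
         `|F y - F x - derive1 F x * (y - x)| <= eta / 2 * `|y - x|)).
    have eta2 : 0 < eta / 2 by rewrite divr_gt0.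
    near (0 : R)^'+ => r; exists r; split; first by near: r; exact: nbhs_right_gt.
    split; near: r; first exact: derivable_linear_approx (df x xcd) eta2.
    exact: derivable_linear_approx dF eta2.
  exists r => // u w cu wd /andP[xu ux] /andP[xw wx].
  have := Wnd _ _ ux; have := Wnd _ _ xw.
  have := hf u xu ltac:(lra); have := hF u xu ltac:(lra).
  have := hf w ltac:(lra) wx; have := hF w ltac:(lra) wx.
  rewrite F'x (ger0_norm (_ : 0 <= w - x)) ?subr_ge0// (ler0_norm (_ : u - x <= 0)) ?subr_le0//.
  rewrite !ler_norml /phi => /andP[? ?] /andP[? ?] /andP[? ?] /andP[? ?] ? ?.
  by apply/andP; split; lra.
Unshelve. all: end_near. Qed.
End derivable_FTC.

(** * Equality, and passage to a half-open interval *)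

Section derivable_FTC2.
Context {R : realType}.
Local Notation mu := (@lebesgue_measure R).

(** The reverse inequality is the same one applied to [- f]. *)
Lemma derivable_FTC_cc (f : R -> R) (c d : R) : c < d ->
    (forall x, c <= x <= d -> derivable f x 1) ->
    mu.-integrable `[c, d] (EFin \o (derive1 f)) ->
  \int[mu]_(x in `[c, d]) derive1 f x = f d - f c.
Proof.
move=> cd df ig; apply/le_anti/andP; split; last exact: derivable_FTC_le.
have dN x : c <= x <= d -> derive1 (- f) x = - derive1 f x.
  by move=> xcd; rewrite !derive1E deriveN//; exact: df.
have iN : mu.-integrable `[c, d] (EFin \o derive1 (- f)).
  apply: eq_integrable (integrableN ig) => // x.
  by rewrite inE/= in_itv/= => /dN ->.
have := derivable_FTC_le cd (fun x xcd => derivableN (df x xcd)) iN.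
rewrite (_ : \int[mu]_(x in _) derive1 (- f) x = - \int[mu]_(x in `[c, d]) derive1 f x).
  by rewrite !fctE; lra.
rewrite -[RHS]mulN1r -(@RintegralZl _ _ _ mu `[c, d] (derive1 f) (-1))//; apply: eq_Rintegral => x; rewrite inE/= in_itv/= => xcd.
by rewrite dN// mulN1r.
Qed.

(** Apply the compact case on [[x, t]] and let [x] decrease to [a]. The integral over []a, x]] tends
    to 0, and uniqueness of limits identifies the two sides. *)
Lemma derivable_FTC_oc (f : R -> R) (a t l : R) : a < t ->
    (forall x, a < x <= t -> derivable f x 1) ->
    f x @[x --> a^'+] --> l ->
    mu.-integrable `]a, t] (EFin \o (derive1 f)) ->
  \int[mu]_(x in `]a, t]) derive1 f x = f t - l.
Proof.
move=> at_ df fa ig; pose g := (derive1 f) \_ `]a, t].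
have igat : mu.-integrable `[a, t] (EFin \o g).
  rewrite /g -restrict_EFin; apply/integrable_restrict => //=.
  by rewrite setIidr//; apply: subset_itvr; rewrite bnd_simp.
have /cvg_at_right_filter g0 := parameterized_integral_cvg_left at_ igat.
have lim1 : f t - f x @[x --> a^'+] --> f t - l by apply: cvgB fa; exact: cvg_cst.
have lim2 : \int[mu]_(y in `]a, t]) derive1 f y - parameterized_integral mu a x g @[x --> a^'+]
    --> \int[mu]_(y in `]a, t]) derive1 f y - 0 by apply: cvgB g0; exact: cvg_cst.
rewrite subr0 in lim2.
suff lim3 : \int[mu]_(y in `]a, t]) derive1 f y - parameterized_integral mu a x g @[x --> a^'+]
    --> f t - l.
  by rewrite -(cvg_lim (@Rhausdorff R) lim2) (cvg_lim (@Rhausdorff R) lim3).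
apply: cvg_trans lim1; apply: near_eq_cvg; near=> x.
have ax : a < x by near: x; exact: nbhs_right_gt.
have xt : x < t by near: x; exact: nbhs_right_lt.
have ixt : mu.-integrable `]x, t] (EFin \o (derive1 f)).
  by apply: integrableS ig => //; apply: subset_itvr; rewrite bnd_simp ltW.
have ixt' : mu.-integrable `[x, t] (EFin \o (derive1 f)).
  by apply: integrableS ig => //; apply: subset_itvr; rewrite bnd_simp.
rewrite -(derivable_FTC_cc xt)//; last first.
  by move=> y /andP[xy yt]; apply: df; rewrite yt (lt_le_trans ax).
rewrite -Rintegral_itv_obnd_cbnd// -(Rintegral_itvB ig) ?bnd_simp ?ltW//.
congr (_ - _); rewrite /parameterized_integral -Rintegral_itv_obnd_cbnd; last first.
  by apply: integrableS igat => //; apply: subset_itv; rewrite bnd_simp// ltW.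
apply: eq_Rintegral => y yax; rewrite /g patchE mem_set//.
by move: yax; rewrite inE; apply: subset_itvl; rewrite bnd_simp ltW.
Unshelve. all: end_near. Qed.
End derivable_FTC2.

(** * Nonvanishing of the Gamma function *)

Lemma ln_leB1 (R : realType) (x : R) : 0 < x -> ln x <= x - 1.
Proof. by move=> x0; rewrite -{1}(subrKC 1 x) le_ln1Dx//; lra. Qed.

(** In other words x^r e^(-x) is largest at x = r. This is the tangent bound for [ln] taken at
    [x / r]. *)
Lemma mul_ln_le (R : realType) (r x : R) : 0 < r -> 0 < x ->
  r * ln x <= r * ln r + x - r.
Proof.
move=> r0 x0; have xr : 0 < x / r by rewrite divr_gt0.
have := ln_leB1 xr; rewrite ln_div ?posrE// => /(ler_wpM2l (ltW r0)).
rewrite !mulrBr mulr1 mulrCA divff ?gt_eqF// mulr1; lra.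
Qed.

Lemma sin_ler (R : realType) (x : R) : 0 <= x -> `|sin x| <= x.
Proof.
rewrite le_eqVlt => /predU1P[<-|x0]; first by rewrite sin0 normr0.
have [|c _] := @MVT R sin cos 0 x x0 (fun y _ => is_derive_sin y).
  by apply: continuous_subspaceT => y; exact: continuous_sin.
rewrite sin0 !subr0 => ->; rewrite normrM (gtr0_norm x0).
by rewrite ler_piMl ?(ltW x0)// ler_norml cos_geN1 cos_le1.
Qed.

(** Combine cos x = 1 - 2 sin^2 (x / 2) with |sin y| <= |y|. *)
Lemma cos_ge_quadratic (R : realType) (x : R) : 1 - x ^+ 2 / 2 <= cos x.
Proof.
have h : `|sin (x / 2)| ^+ 2 <= (x / 2) ^+ 2.
  rewrite -(real_normK (num_real (x / 2))) lerXn2r ?nnegrE//.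
  have [x0|x0] := leP 0 (x / 2); first by rewrite (le_trans (sin_ler x0))// ler_norm.
  by rewrite -normrN -sinN (ltr0_norm x0) sin_ler// oppr_ge0 ltW.
have cE := cos2Dsin2 (x / 2).
have := cosD (x / 2) (x / 2); rewrite -splitr => ->.
by move: h; rewrite real_normK ?num_real// -!expr2; lra.
Qed.

(** For [|y - 1| <= 1 / 2] one has [|ln y| <= 2 * |y - 1|], and the quadratic bound on [cos]
    produces [2 * tau ^+ 2]. Elsewhere [(y - 1) ^+ 2] is at least 1/4, so the constant 8 brings the
    left side down to -1. Being quadratic in [y], the bound can be integrated through moments. *)
Lemma cos_mul_ln_ge (R : realType) (tau y : R) : 0 < y ->
  1 - (2 * tau ^+ 2 + 8) * (y - 1) ^+ 2 <= cos (tau * ln y).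
Proof.
move=> y0; have [y1|y1] := leP (`|y - 1|) (1 / 2).
  have yV : 0 < y^-1 by rewrite invr_gt0.
  have yV2 : y^-1 <= 2.
    rewrite -[2]invrK lef_pV2 ?posrE ?invr_gt0//.
    by move: y1; rewrite ler_norml => /andP[]; lra.
  have lnyV := ln_leB1 yV; rewrite lnV ?posrE// in lnyV.
  have yVE : y^-1 - 1 = (1 - y) * y^-1 by rewrite mulrBl mul1r divff ?gt_eqF.
  have lny : `|ln y| <= 2 * `|y - 1|.
    rewrite ler_norml; apply/andP; split.
      rewrite lerNl (le_trans lnyV)// yVE (le_trans (ler_norm _))// normrM distrC mulrC.
      by rewrite (gtr0_norm yV) ler_wpM2r.
    rewrite (le_trans (ln_leB1 y0))// (le_trans (ler_norm _))//.
    by rewrite ler_peMl// ler1n.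
  have lny2 : ln y ^+ 2 <= 4 * (y - 1) ^+ 2.
    rewrite -(real_normK (num_real (ln y))) -(real_normK (num_real (y - 1))).
    have -> : 4 * `|y - 1| ^+ 2 = (2 * `|y - 1|) ^+ 2 by ring.
    by rewrite lerXn2r ?nnegrE// mulr_ge0.
  apply: le_trans (cos_ge_quadratic _); rewrite exprMn.
  have := ler_wpM2l (sqr_ge0 tau) lny2; have := sqr_ge0 (y - 1); lra.
have : (1 / 2) ^+ 2 <= (y - 1) ^+ 2.
  by rewrite -[leRHS](real_normK (num_real _)) lerXn2r ?nnegrE// ?ltW//; lra.
have := mulr_ge0 (sqr_ge0 tau) (sqr_ge0 (y - 1)); have := cos_geN1 (tau * ln y); lra.
Qed.

(** * Integrals over the positive half-line *)

Section integral0y.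
Context {R : realType}.
Local Notation mu := (@lebesgue_measure R).

(** By monotone convergence it suffices to bound the integrals over compact intervals exhausting the
    half-line. Each is a difference of two values of [G], hence at most [B]. *)
Lemma bounded_derivative_integrable (G h : R -> R) (B : R) :
    (forall x : R, 0 < x -> is_derive x 1 G (h x)) ->
    (forall x : R, 0 < x -> 0 <= h x) ->
    {in `]0, +oo[, continuous h} ->
    (forall x : R, 0 < x -> 0 <= G x <= B) ->
  mu.-integrable `]0, +oo[ (EFin \o h).
Proof.
move=> dG h0 ch GB.
have mh : measurable_fun (`]0, +oo[%classic : set R) h.
  apply: open_continuous_measurable_fun; first exact: interval_open.
  by move=> x; rewrite inE => /ch.
have emh : measurable_fun (`]0, +oo[%classic : set R) (EFin \o h) by exact/measurable_EFinP.
apply/integrableP; split => //.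
have cG (x : R) : 0 < x -> {for x, continuous G}.
  by move=> /dG[dGx _]; exact/differentiable_continuous/derivable1_diffP.
(* Starting at 2 makes every interval nondegenerate, as the fundamental theorem below requires. *)
pose F (n : nat) := `[n.+2%:R^-1, n.+2%:R : R]%classic.
have F0 n x : F n x -> 0 < x.
  rewrite /F /= in_itv/= => /andP[+ _]; apply: lt_le_trans.
  by rewrite invr_gt0 ltr0n.
have FS n : F n `<=` `]0, +oo[ by move=> x /F0; rewrite /= in_itv/= andbT.
have FE : (`]0, +oo[%classic : set R) = \bigcup_n F n.
  apply/seteqP; split=> x /=; last by move=> [n _ /F0]; rewrite in_itv/= andbT.
  rewrite in_itv/= andbT => x0.
  have xV0 : 0 < x^-1 by rewrite invr_gt0.
  exists (Num.truncn x + Num.truncn x^-1)%N => //; rewrite /F/= in_itv/=.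
  apply/andP; split; last first.
    by rewrite (le_trans (ltW (truncnS_gt x)))// ler_nat ltnS leqW// leq_addr.
  rewrite -[leRHS]invrK lef_pV2 ?posrE// (le_trans (ltW (truncnS_gt x^-1)))// ler_nat.
  by rewrite ltnS leqW// leq_addl.
have -> : (\int[mu]_(x in `]0%R, +oo[) `|(EFin \o h) x| = \int[mu]_(x in \bigcup_n F n) (EFin \o h) x)%E.
  rewrite -FE; apply: eq_integral => x; rewrite inE/= in_itv/= andbT => x0.
  by rewrite ger0_norm// h0.
have mF n : measurable (F n) by exact: measurable_itv.
have cvgF : (\int[mu]_(x in F n) (EFin \o h) x)%E @[n --> \oo] -->
    (\int[mu]_(x in \bigcup_n F n) (EFin \o h) x)%E.
  apply: ge0_nondecreasing_set_cvg_integral => //.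
  - move=> n m nm; apply/subsetPset/subset_itv; rewrite bnd_simp.
      by rewrite lef_pV2 ?posrE// ler_nat.
    by rewrite ler_nat.
  - by move=> n; apply: measurable_funS emh.
  - by move=> n x /F0/h0; rewrite lee_fin.
rewrite -(cvg_lim _ cvgF)//.
apply: (@le_lt_trans _ _ B%:E); last exact: ltry.
apply: lime_le; first by apply/cvg_ex; eexists; exact: cvgF.
apply: nearW => n; rewrite (@continuous_FTC2 _ h G).
- rewrite -EFinB lee_fin.
  have /GB/andP[_ GnB] : 0 < n.+2%:R :> R by rewrite ltr0n.
  have /GB/andP[Gn0 _] : 0 < n.+2%:R^-1 :> R by rewrite invr_gt0 ltr0n.
  by lra.
- by rewrite (@lt_trans _ _ 1)// ?invf_lt1 ?ltr0n// ltr1n.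
- apply: continuous_in_subspaceT => x; rewrite inE => /F0 x0.
  by apply: ch; rewrite in_itv/= x0.
- split.
  + move=> x xn; have /dG[//] : 0 < x.
    by apply: (F0 n); rewrite /F /=; apply: subset_itv xn; rewrite bnd_simp.
  + by apply: cvg_at_right_filter; apply: cG; rewrite invr_gt0 ltr0n.
  + by apply: cvg_at_left_filter; apply: cG; rewrite ltr0n.
- move=> x xn; rewrite derive1E; have x0 : 0 < x.
    by apply: (F0 n); rewrite /F /=; apply: subset_itv xn; rewrite bnd_simp.
  by have [_] := dG x x0.
Qed.

(** Monotone convergence settles nonnegative functions, and [h] is the difference of the nonnegative
    functions [|h| + h] and [|h|]. *)
Lemma cvg_Rintegral_0y (h : R -> R) : mu.-integrable `]0, +oo[ (EFin \o h) ->
  \int[mu]_(x in `]0, n.+1%:R]) h x @[n --> \oo] --> \int[mu]_(x in `]0, +oo[) h x.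
Proof.
pose F (n : nat) := `]0, n.+1%:R : R]%classic.
have FE : (`]0, +oo[%classic : set R) = \bigcup_n F n.
  apply/seteqP; split=> x /=; last by move=> [n _]; rewrite /F /= !in_itv/= andbT => /andP[].
  rewrite in_itv/= andbT => x0; exists (Num.truncn x) => //; rewrite /F/= in_itv/= x0/=.
  exact/ltW/truncnS_gt.
have FS n : F n `<=` `]0, +oo[ by move=> x; rewrite /F/= !in_itv/= andbT => /andP[].
have ge0 (k : R -> R) : mu.-integrable `]0, +oo[ (EFin \o k) -> (forall x, 0 <= k x) ->
    \int[mu]_(x in `]0, n.+1%:R]) k x @[n --> \oo] --> \int[mu]_(x in `]0, +oo[) k x.
  move=> ik k0; apply: fine_cvg; rewrite fineK; last exact: integrable_fin_num.
  rewrite FE; apply: ge0_nondecreasing_set_cvg_integral.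
  - move=> n m nm; apply/subsetPset/subset_itv; rewrite bnd_simp//.
    by rewrite ler_nat.
  - by move=> n; exact: measurable_itv.
  - by move=> n; apply: measurable_funS (measurable_int _ ik) => //; exact: FS.
  - by move=> n x _; rewrite lee_fin.
move=> ih.
have iah : mu.-integrable `]0, +oo[ (EFin \o (fun x => `|h x|)) by exact: integrable_abse ih.
have iD : mu.-integrable `]0, +oo[ (EFin \o (fun x => `|h x| + h x)).
  exact: (integrableD _ iah ih).
have hE (D : set R) : measurable D -> D `<=` `]0, +oo[ -> \int[mu]_(x in D) h x =
    \int[mu]_(x in D) (`|h x| + h x) - \int[mu]_(x in D) `|h x|.
  move=> mD DS; rewrite RintegralD//; [|exact: integrableS iah|exact: integrableS ih].
  by rewrite addrAC subrr add0r.
rewrite hE//; under eq_fun do rewrite (hE _ (measurable_itv _) (@FS _)).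
apply: cvgB; apply: ge0 => // x.
by rewrite -lerBlDr sub0r (le_trans (ler_norm _))// normrN.
Qed.

(** This is integration by parts with vanishing boundary terms, the source of the functional
    equation of Gamma. *)
Lemma Rintegral_0y_derivative (G h : R -> R) :
    (forall x : R, 0 < x -> is_derive x 1 G (h x)) ->
    mu.-integrable `]0, +oo[ (EFin \o h) ->
    G x @[x --> 0^'+] --> 0 -> G x @[x --> +oo] --> 0 ->
  \int[mu]_(x in `]0, +oo[) h x = 0.
Proof.
move=> dG ih G0 Gy.
have n0 (n : nat) : 0 < n.+1%:R :> R by rewrite ltr0n.
have FS n : `]0, n.+1%:R : R] `<=` `]0, +oo[.
  by move=> x; rewrite /= !in_itv/= andbT => /andP[].
have E n : \int[mu]_(x in `]0, n.+1%:R]) h x = G n.+1%:R.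
  rewrite -[RHS]subr0 -(derivable_FTC_oc (n0 n) _ G0).
  - apply: eq_Rintegral => x; rewrite inE/= in_itv/= => /andP[x0 _].
    by rewrite derive1E (@derive_val _ _ _ _ _ _ _ (dG x x0)).
  - by move=> x /andP[x0 _]; have := dG x x0.
  - have ihn : mu.-integrable `]0, n.+1%:R] (EFin \o h) 
      by apply: integrableS ih => //; exact: FS.
    apply: eq_integrable ihn => //= x.
    rewrite inE/= in_itv/= => /andP[x0 _].
    by rewrite derive1E (@derive_val _ _ _ _ _ _ _ (dG x x0)).
have := cvg_Rintegral_0y ih; under eq_fun do rewrite E.
have : G n.+1%:R @[n --> \oo] --> 0.
  have /cvg_pinftyP/(_ _ cvgr_idn) := Gy.
  by rewrite -cvg_shiftS.
move=> /(cvg_lim (@Rhausdorff R)) h1 /(cvg_lim (@Rhausdorff R)).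
by rewrite h1.
Qed.
End integral0y.

(** * Euler's integral with a rotated phase *)

Section gamma_integrals.
Context {R : realType}.
Local Notation mu := (@lebesgue_measure R).

(* gamma_integral s tau phi below is the real part of e^(i phi) Gamma (s + i tau);
   phi = 0 and phi = - pi / 2 give the real and the imaginary part of Gamma. *)
Definition gamma_kernel (s tau phi x : R) : R :=
  expR ((s - 1) * ln x - x) * cos (tau * ln x + phi).

Lemma is_derive1_continuous (f : R -> R) (x df : R) :
  is_derive x 1 f df -> {for x, continuous f}.
Proof. by move=> [dfx _]; exact/differentiable_continuous/derivable1_diffP. Qed.

(** The sine produced by differentiation is written as a cosine with phase lowered by [pi / 2], so
    the derivative stays in the span of the kernels. *)
Lemma is_derive_gamma_kernel (s tau phi x : R) : 0 < x ->
  is_derive x 1 (fun y => expR (s * ln y - y) * cos (tau * ln y + phi))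
    (s * gamma_kernel s tau phi x - tau * gamma_kernel s tau (phi - pi / 2) x
     - gamma_kernel (s + 1) tau phi x).
Proof.
move=> x0; have dln := is_derive1_ln x0.
have d1 : is_derive x 1 (fun y => s * ln y - y) (s * x^-1 - 1).
  exact: is_deriveB.
have d2 : is_derive x 1 (fun y => tau * ln y + phi) (tau * x^-1 + 0).
  exact: is_deriveD.
have e1 := @is_derive1_comp _ expR (fun y => s * ln y - y) _ _ _ (is_derive_expR _) d1.
have e2 := @is_derive1_comp _ cos (fun y => tau * ln y + phi) _ _ _ (is_derive_cos _) d2.
apply: is_derive_eq (is_deriveM e1 e2) _ => /=.
rewrite /gamma_kernel addrA cosBpihalf.
have -> : expR (s * ln x - x) = x * expR ((s - 1) * ln x - x).
  transitivity (expR (ln x) * expR ((s - 1) * ln x - x)); last by rewrite lnK ?posrE.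
  by rewrite -expRD; congr expR; ring.
have -> : expR ((s + 1 - 1) * ln x - x) = x * expR ((s - 1) * ln x - x).
  transitivity (expR (ln x) * expR ((s - 1) * ln x - x)); last by rewrite lnK ?posrE.
  by rewrite -expRD; congr expR; ring.
rewrite /GRing.scale /=; field; exact: lt0r_neq0.
Qed.

(* For k = l = s this is (x / (1 + x))^s, bounded with derivative s times the case
   k = s - 1, l = s + 1. *)
Definition gamma_majorant (k l x : R) : R := expR (k * ln x - l * ln (1 + x)).

Lemma is_derive_gamma_majorant (k l x : R) : 0 < x ->
  is_derive x 1 (gamma_majorant k l) (gamma_majorant k l x * (k / x - l / (1 + x))).
Proof.
move=> x0; have dln := is_derive1_ln x0.
have dln1 : is_derive x 1 (fun y : R => ln (1 + y)) (1 + x)^-1.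
  have d1 : is_derive x 1 (fun y : R => 1 + y) (0 + 1) by exact: is_deriveD.
  rewrite add0r in d1; have x1 : 0 < 1 + x by lra.
  have := @is_derive1_comp _ (@ln R) (fun y : R => 1 + y) x _ _ (is_derive1_ln x1) d1.
  by rewrite mulr1.
have d2 := is_deriveB (is_deriveZ k dln) (is_deriveZ l dln1).
exact: (@is_derive1_comp _ expR (fun y => k * ln y - l * ln (1 + y)) _ _ _ (is_derive_expR _) d2).
Qed.

Lemma integrable_gamma_majorant (s : R) : 0 < s ->
  mu.-integrable `]0, +oo[ (EFin \o gamma_majorant (s - 1) (s + 1)).
Proof.
move=> s0.
apply: (@bounded_derivative_integrable R (s^-1 \*: gamma_majorant s s)
  (gamma_majorant (s - 1) (s + 1)) s^-1).
- move=> x x0; apply: is_derive_eq (is_deriveZ _ (is_derive_gamma_majorant s s x0)) _.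
  rewrite /gamma_majorant /GRing.scale/=.
  have -> : expR (s * ln x - s * ln (1 + x)) =
      x * (1 + x) * expR ((s - 1) * ln x - (s + 1) * ln (1 + x)).
    transitivity (expR (ln x) * expR (ln (1 + x)) * expR ((s - 1) * ln x - (s + 1) * ln (1 + x))).
      by rewrite -!expRD; congr expR; ring.
    by rewrite !lnK ?posrE// addr_gt0.
  by field; rewrite !gt_eqF// addr_gt0.
- by move=> x _; exact: expR_ge0.
- move=> x; rewrite in_itv/= andbT => x0.
  exact: is_derive1_continuous (is_derive_gamma_majorant _ _ x0).
- move=> x x0; rewrite /GRing.scale/= mulr_ge0 ?invr_ge0 ?expR_ge0 ?(ltW s0)//=.
  rewrite ler_piMr ?invr_ge0 ?(ltW s0)// -expR0 ler_expR -mulrBr.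
  rewrite mulr_ge0_le0 ?(ltW s0)// subr_le0 ler_ln ?posrE ?addr_gt0//.
  by rewrite lerDr.
Qed.

Lemma integrable_gamma_kernel (s tau phi : R) : 0 < s ->
  mu.-integrable `]0, +oo[ (EFin \o gamma_kernel s tau phi).
Proof.
move=> s0; have ih := integrable_gamma_majorant s0.
(* By [mul_ln_le] with exponent [s + 1] at the point [1 + x], e^(-x) is at most e^c (1 + x)^(-(s +
   1)). *)
pose c := (s + 1) * ln (s + 1) + 1 - (s + 1).
pose h : R -> R := gamma_majorant (s - 1) (s + 1).
have icor : mu.-integrable `]0, +oo[ (EFin \o (fun x => expR c * h x)).
  exact: integrableZl ih.
apply: le_integrable icor => //.
  apply/measurable_EFinP; apply: open_continuous_measurable_fun.
    exact: interval_open.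
  move=> x; rewrite inE/= in_itv/= andbT => x0.
  exact: is_derive1_continuous (is_derive_gamma_kernel _ _ _ x0).
move=> x; rewrite /= in_itv/= andbT => x0; rewrite lee_fin.
rewrite (ger0_norm (_ : 0 <= expR c * h x)); last first.
  by rewrite mulr_ge0 ?expR_ge0.
rewrite normrM (ger0_norm (expR_ge0 _)).
apply: (@le_trans _ _ (expR ((s - 1) * ln x - x))).
  by rewrite ler_piMr ?expR_ge0// ler_norml cos_geN1 cos_le1.
rewrite /h /gamma_majorant -expRD ler_expR /c.
have s1 : 0 < s + 1 by lra. have x1 : 0 < 1 + x by lra.
have := mul_ln_le s1 x1; lra.
Qed.

Definition gamma_integral (s tau phi : R) : R :=
  \int[mu]_(x in `]0, +oo[) gamma_kernel s tau phi x.

(** This is the real part of e^(i phi) Gamma(z + 1) = e^(i phi) z Gamma(z) at z = s + i tau: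
    multiplication by -i lowers the phase by [pi / 2]. *)
Lemma gamma_integralS (s tau phi : R) : 0 < s ->
  gamma_integral (s + 1) tau phi =
  s * gamma_integral s tau phi - tau * gamma_integral s tau (phi - pi / 2).
Proof.
move=> s0; have s1 : 0 < s + 1 by lra.
have i1 := integrable_gamma_kernel tau phi s0.
have i2 := integrable_gamma_kernel tau (phi - pi / 2) s0.
have i3 := integrable_gamma_kernel tau phi s1.
have i1' : mu.-integrable `]0, +oo[ (EFin \o (fun x => s * gamma_kernel s tau phi x)).
  exact: integrableZl i1.
have i2' : mu.-integrable `]0, +oo[ (EFin \o (fun x => tau * gamma_kernel s tau (phi - pi / 2) x)).
  exact: integrableZl i2.
have i12 : mu.-integrable `]0, +oo[ (EFin \o (fun x => s * gamma_kernel s tau phi x - tau * gamma_kernel s tau (phi - pi / 2) x)).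
  exact: (integrableB _ i1' i2').
have i123 : mu.-integrable `]0, +oo[ (EFin \o (fun x => s * gamma_kernel s tau phi x - tau * gamma_kernel s tau (phi - pi / 2) x - gamma_kernel (s + 1) tau phi x)).
  exact: (integrableB _ i12 i3).
have := Rintegral_0y_derivative (is_derive_gamma_kernel s tau phi) i123.
rewrite RintegralB// RintegralB// !RintegralZl// => /(_ _ _)/eqP; rewrite subr_eq0 => H.
apply/esym/eqP; apply: H.
- have p0 : @powR R ^~ s x @[x --> 0^'+] --> 0 by exact: powR_cvg0.
  apply: norm_cvg0; apply: (squeeze_cvgr _ (cvg_cst 0) p0); near=> x.
  have x0 : 0 < x by near: x; exact: nbhs_right_gt.
  rewrite normr_ge0/= normrM (ger0_norm (expR_ge0 _)) (le_trans (y := expR (s * ln x - x)))//.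
    by rewrite ler_piMr ?expR_ge0// ler_norml cos_geN1 cos_le1.
  by rewrite /powR gt_eqF// ler_expR; lra.
(* By [mul_ln_le] with exponent [s + 1], x^s e^(-x) is at most e^c / x. *)
- pose c := (s + 1) * ln (s + 1) - (s + 1).
  have p0 : expR c * x^-1 @[x --> +oo] --> expR c * 0.
    apply: cvgM; first exact: cvg_cst.
    by apply/gtr0_cvgV0 => //; near=> x; near: x; exact: nbhs_pinfty_gt.
  rewrite mulr0 in p0.
  apply: norm_cvg0; apply: (squeeze_cvgr _ (cvg_cst 0) p0); near=> x.
  have x0 : 0 < x by near: x; exact: nbhs_pinfty_gt.
  rewrite normr_ge0/= normrM (ger0_norm (expR_ge0 _)) (le_trans (y := expR (s * ln x - x)))//.
    by rewrite ler_piMr ?expR_ge0// ler_norml cos_geN1 cos_le1.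
  have -> : x^-1 = expR (- ln x) by rewrite expRN lnK ?posrE.
  rewrite -expRD ler_expR.
  by have := mul_ln_le s1 x0; rewrite /c; lra.
Unshelve. all: end_near. Qed.

(** If the real and imaginary parts of Gamma both vanish, then so does the integral for every
    phase. *)
Lemma gamma_integralE (s tau phi : R) : 0 < s ->
  gamma_integral s tau phi =
  cos phi * gamma_integral s tau 0 - sin phi * gamma_integral s tau (- (pi / 2)).
Proof.
move=> s0.
have i1 := integrable_gamma_kernel tau 0 s0.
have i2 := integrable_gamma_kernel tau (- (pi / 2)) s0.
rewrite /gamma_integral -!RintegralZl// -RintegralB//.
- apply: eq_Rintegral => x _; rewrite /gamma_kernel cosBpihalf addr0 cosD; ring.
- exact: integrableZl i1.
- exact: integrableZl i2.
Qed.

Lemma mulr_gamma_kernel (s tau phi x : R) : 0 < x ->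
  x * gamma_kernel s tau phi x = gamma_kernel (s + 1) tau phi x.
Proof.
move=> x0; rewrite /gamma_kernel mulrA; congr (_ * _).
transitivity (expR (ln x) * expR ((s - 1) * ln x - x)); first by rewrite lnK ?posrE.
by rewrite -expRD; congr expR; ring.
Qed.

(* The Gamma distribution of shape s has mean s and variance s, hence concentrates
   around s, where the rotated phase tau * ln (x / s) is small. *)
Lemma gamma_integral_lower_bound (s tau : R) : 0 < s ->
  gamma_integral s 0 0 * (1 - (2 * tau ^+ 2 + 8) / s) <= gamma_integral s tau (- (tau * ln s)).
Proof.
move=> s0; have s1 : 0 < s + 1 by lra.
have s2 : 0 < s + 1 + 1 by lra.
set K := 2 * _ + 8.
have i0 := integrable_gamma_kernel 0 0 s0.
have i1 := integrable_gamma_kernel 0 0 s1.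
have i2 := integrable_gamma_kernel 0 0 s2.
have il0 : mu.-integrable `]0, +oo[ (EFin \o (fun x => (1 - K) * gamma_kernel s 0 0 x)).
  exact: integrableZl i0.
have il1 : mu.-integrable `]0, +oo[ (EFin \o (fun x => (2 * K / s) * gamma_kernel (s + 1) 0 0 x)).
  exact: integrableZl i1.
have il2 : mu.-integrable `]0, +oo[ (EFin \o (fun x => (K / s ^+ 2) * gamma_kernel (s + 1 + 1) 0 0 x)).
  exact: integrableZl i2.
have il01 : mu.-integrable `]0, +oo[ (EFin \o (fun x => (1 - K) * gamma_kernel s 0 0 x + (2 * K / s) * gamma_kernel (s + 1) 0 0 x)).
  exact: (integrableD _ il0 il1).
have il : mu.-integrable `]0, +oo[ (EFin \o (fun x => (1 - K) * gamma_kernel s 0 0 x + (2 * K / s) * gamma_kernel (s + 1) 0 0 x - (K / s ^+ 2) * gamma_kernel (s + 1 + 1) 0 0 x)).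
  exact: (integrableB _ il01 il2).
(* The integrand is the kernel times [1 - K * (x / s - 1) ^+ 2], expanded in powers of [x], each of
   which raises the shape by one. *)
have <- : \int[mu]_(x in `]0, +oo[) ((1 - K) * gamma_kernel s 0 0 x + (2 * K / s) * gamma_kernel (s + 1) 0 0 x - (K / s ^+ 2) * gamma_kernel (s + 1 + 1) 0 0 x) =
    gamma_integral s 0 0 * (1 - K / s).
  rewrite RintegralB// RintegralD// !RintegralZl//.
  rewrite -!/(gamma_integral _ _ _) !gamma_integralS//.
  by field; rewrite gt_eqF.
apply: le_Rintegral => //; first exact: integrable_gamma_kernel.
move=> x; rewrite /= in_itv/= andbT => x0.
rewrite -!mulr_gamma_kernel// /gamma_kernel mul0r add0r cos0 mulr1 -mulrBr -ln_div ?posrE//.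
have := cos_mul_ln_ge tau (divr_gt0 x0 s0); rewrite -/K.
move=> /(ler_wpM2l (expR_ge0 ((s - 1) * ln x - x))); apply: le_trans.
set e := expR _; rewrite le_eqVlt; apply/orP; left; apply/eqP; field.
by rewrite gt_eqF.
Qed.

Lemma gamma_integral_gt0 (s : R) : 0 < s -> 0 < gamma_integral s 0 0.
Proof.
move=> s0; have i0 := integrable_gamma_kernel 0 0 s0.
have k0 x : 0 <= gamma_kernel s 0 0 x.
  by rewrite /gamma_kernel mul0r add0r cos0 mulr1 expR_ge0.
have [m m0 mk] : exists2 m : R, 0 < m & forall x, 1 < x -> x <= 2 -> m <= gamma_kernel s 0 0 x.
  (* On []1, 2]] one has [|ln x| <= 1] and [x <= 2]. *)
  exists (expR (- `|s - 1| - 2)); first exact: expR_gt0.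
  move=> x x1 x2; have x0 : 0 < x by lra.
  rewrite /gamma_kernel mul0r add0r cos0 mulr1 ler_expR.
  have := ler_norm (- ((s - 1) * ln x)); rewrite normrN normrM.
  have lnx : `|ln x| <= 1.
    rewrite ger0_norm ?ln_ge0 ?(ltW x1)// (le_trans (ln_leB1 x0))//; lra.
  have := ler_piMr (normr_ge0 (s - 1)) lnx; lra.
have i1y : mu.-integrable `]1, +oo[ (EFin \o gamma_kernel s 0 0).
  by apply: integrableS i0 => //; apply: subset_itvr; rewrite bnd_simp.
have i12 : mu.-integrable `]1, 2] (EFin \o gamma_kernel s 0 0).
  by apply: integrableS i1y => //; apply: subset_itvl; rewrite bnd_simp.
have im : mu.-integrable `]1, 2] (EFin \o cst m).
  have im' : mu.-integrable `[1, 2] (EFin \o cst m).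
    apply: continuous_compact_integrable; first exact: segment_compact.
    by apply: continuous_subspaceT => x; exact: cst_continuous.
  by apply: integrableS im' => //; apply: subset_itvr; rewrite bnd_simp.
have h1 := Rintegral_itvB (x := 1) i0 ltac:(by rewrite bnd_simp) ltac:(by rewrite bnd_simp).
have h2 := Rintegral_itvB (x := 2) i1y ltac:(by rewrite bnd_simp ler1n) ltac:(by rewrite bnd_simp).
have h01 : 0 <= \int[mu]_(x in `]0, 1]) gamma_kernel s 0 0 x by exact: Rintegral_ge0.
have h2y : 0 <= \int[mu]_(x in `]2, +oo[) gamma_kernel s 0 0 x by exact: Rintegral_ge0.
have h12 : m <= \int[mu]_(x in `]1, 2]) gamma_kernel s 0 0 x.
  have -> : m = \int[mu]_(x in `]1, 2]) cst m x.
    rewrite (@Rintegral_cst _ _ _ mu)// [X in fine X]lebesgue_measure_itv/= lte_fin ltr1n/=.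
    by rewrite -addrA subrr addr0 mulr1.
  by apply: le_Rintegral => // x; rewrite /= in_itv/= => /andP[x1 x2]; exact: mk.
apply: (lt_le_trans m0); apply: (le_trans h12).
apply: (@le_trans _ _ (\int[mu]_(x in `]1, +oo[) gamma_kernel s 0 0 x)).
  by rewrite -subr_ge0 h2.
by rewrite -h1 gerBl.
Qed.

Lemma gamma_integral_neq0 (s tau : R) : 0 < s ->
  (gamma_integral s tau 0 != 0) || (gamma_integral s tau (- (pi / 2)) != 0).
Proof.
move=> s0; rewrite -negb_and; apply/negP => /andP[/eqP I0 /eqP I1].
(* The induction carries all phases because the functional equation shifts the phase. *)
have vanish (n : nat) phi : gamma_integral (s + n%:R) tau phi = 0.
  elim: n phi => [|n IH] phi; first by rewrite addr0 gamma_integralE// I0 I1 !mulr0 subr0.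
  by rewrite -natr1 addrA gamma_integralS ?IH ?mulr0 ?subr0// ltr_wpDr.
pose K := 2 * tau ^+ 2 + 8.
(* Since [s + n%:R] exceeds [K], the lower bound is positive there and contradicts the vanishing. *)
pose n := (Num.truncn K).+1.
have sn0 : 0 < s + n%:R by rewrite ltr_wpDr.
have := gamma_integral_lower_bound tau sn0; rewrite vanish.
rewrite pmulr_rle0 ?gamma_integral_gt0// subr_le0 ler_pdivlMr// mul1r.
by apply/negP; rewrite -ltNge (lt_le_trans (truncnS_gt K))// lerDr ltW.
Qed.

End gamma_integrals.

Lemma cGamma_neq0 (R : realType) (z : R[i]) : 0 < complex.Re z -> cGamma z != 0.
Proof.
case: z => s tau /= s0; rewrite /cGamma /cintegral eq_complex negb_and /=.
set I1 := (X in X != 0); set I2 := (X in _ || (X != 0)).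
have -> : I1 = gamma_integral s tau 0.
  apply: eq_Rintegral => x; rewrite inE/= in_itv/= andbT => x0.
  rewrite /gamma_kernel /powR gt_eqF// expRD.
  by rewrite !mul0r !mulr0 !subr0 !addr0; ring.
have -> : I2 = gamma_integral s tau (- (pi / 2)).
  apply: eq_Rintegral => x; rewrite inE/= in_itv/= andbT => x0.
  rewrite /gamma_kernel /powR gt_eqF// expRD cosBpihalf.
  by rewrite !mul0r !mulr0 !subr0 !addr0 ?add0r; ring.
exact: gamma_integral_neq0.
Qed.

(** * The V-derivative *)

Lemma continuous_numField_horner (K : numFieldType) (p : {poly K}) :
  continuous (horner p : K^o -> K^o).
Proof.
move=> x; elim/poly_ind: p => [|p c IH].
  rewrite (_ : horner 0 = cst 0); first exact: cst_continuous.
  by apply/funext => y; rewrite horner0.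
rewrite (_ : horner _ = (horner p : K^o -> K^o) * id + cst c).
  by apply: continuousD; [apply: continuousM => //|exact: cst_continuous].
by apply/funext => y; rewrite hornerMXaddC.
Qed.

(* For small real s the product of the roots of P - (t + s) is, up to sign, s
   divided by the leading coefficient, so one of these roots is small. *)
Lemma exists_small_real_value (R : realType) (P : {poly R[i]}) (t : R) (e : R[i]) :
    P`_0 = t%:C -> (1 < size P)%N -> 0 < e ->
  exists z, [/\ z != 0, `|z| < e & P.[z] \is Num.real].
Proof.
move=> P0 sP e0; set m := (size P).-1.
have l0 : 0 < `|lead_coef P| * e ^+ m.
  rewrite mulr_gt0 ?exprn_gt0// normr_gt0 lead_coef_eq0 -size_poly_gt0.
  exact: ltn_trans sP.
(* If all roots of [p] had modulus at least [e], then [|p.[0]|], which is [s], would be at least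
   [|lead_coef P| * e ^+ m], twice this value. *)
pose s : R := complex.Re (`|lead_coef P| * e ^+ m) / 2.
have lE : (complex.Re (`|lead_coef P| * e ^+ m))%:C = `|lead_coef P| * e ^+ m.
  by rewrite RRe_real// gtr0_real.
have s0 : 0 < s by rewrite divr_gt0// -ltcR lE.
pose p := P - (t + s)%:C%:P.
have sC : (size (- ((t + s)%:C%:P : {poly R[i]})) < size P)%N.
  by rewrite size_polyN (leq_ltn_trans (size_polyC_leq1 _)).
have sp : size p = size P by rewrite /p size_polyDl.
have lp : lead_coef p = lead_coef P by rewrite /p lead_coefDl.
have [r rE] := closed_field_poly_normal p.
have [|/hasPn allr] := boolP (has (fun z => `|z| < e) r).
  move=> /hasP[z zr ze]; have pz : root p z.
    rewrite rE rootZ; first by rewrite root_prod_XsubC.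
    by rewrite lead_coef_eq0 -size_poly_gt0 sp (ltn_trans _ sP).
  move: pz; rewrite /p rootE !hornerE subr_eq0 => /eqP Pz.
  exists z; split => //; last by rewrite Pz; apply/complex_realP; eexists.
  apply/eqP => z0; move: Pz; rewrite z0 horner_coef0 P0 => /complexI/eqP.
  by rewrite addrC -subr_eq subrr eq_sym gt_eqF.
exfalso.
have : p.[0] = - s%:C by rewrite /p !hornerE horner_coef0 P0 rmorphD/=; ring.
rewrite rE hornerZ horner_prod => /(congr1 Num.norm).
rewrite normrM normrN lp normr_prod.
have -> : `|s%:C : R[i]| = s%:C by rewrite ger0_norm// ler0c ltW.
have rm : size r = m.
  by rewrite /m -sp rE size_scale ?size_prod_XsubC// lead_coef_eq0 -size_poly_gt0 sp (ltn_trans _ sP).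
have ler : e ^+ m <= \prod_(z <- r) `|('X - z%:P).[0]|.
  rewrite -rm; have -> : e ^+ size r = \prod_(z <- r) e.
    by rewrite big_const_seq count_predT iter_mulr_1.
  rewrite big_seq [leRHS]big_seq; apply: ler_prod => z /allr ze.
  rewrite (ltW e0)/= hornerXsubC sub0r normrN real_leNgt ?normr_real//.
  exact: gtr0_real.
move=> E; have : `|lead_coef P| * e ^+ m <= s%:C by rewrite -E ler_wpM2l.
rewrite -lE lecR /s.
by move: s0; rewrite /s; lra.
Qed.

Lemma normr_real_complex (R : rcfType) (x : R) : `|x%:C| = `|x|%:C :> R[i].
Proof. by rewrite normc_def /= expr0n addr0 sqrtr_sqr. Qed.

(** This is the chain rule in Caratheodory's form. Writing P(e) = t + e Q(e), the quotient equals
    g(P(e)) Q(e), where [g] is the slope of [h] at [t] extended by [derive1 h t], hence continuous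
    at [t]. *)
Lemma cvg_real_valued_quotient (R : realType) (P : {poly R[i]}) (h : R -> R) (t : R) :
    P`_0 = t%:C -> derivable h t 1 ->
  (((h (complex.Re P.[e]) - h t)%:C / e : R[i]^o)
    @[e --> within [set e : R[i]^o | P.[e] \is Num.real] (0 : R[i]^o)^'])
  --> ((derive1 h t)%:C * P`_1 : R[i]^o).
Proof.
move=> P0 dh; pose Q := drop_poly 1 P.
pose g (y : R) := if y == t then derive1 h t else (h y - h t) / (y - t).
set F := within _ _.
have FF : Filter F by exact: within_filter.
have F0 : F --> (0 : R[i]^o) by apply: cvg_trans (cvg_within _) _; exact: cvg_within.
have PQ e : P.[e] = t%:C + Q.[e] * e.
  rewrite -{1}(poly_take_drop 1 P) hornerD hornerM hornerXn expr1; congr (_ + _).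
  have -> : take_poly 1 P = t%:C%:P; last by rewrite hornerC.
  by apply/polyP => -[|k]; rewrite coef_take_poly coefC.
have Q0 : P`_1 = Q.[0] by rewrite horner_coef0 coef_drop_poly.
have cQ : (Q.[e] : R[i]^o) @[e --> F] --> (Q.[0] : R[i]^o).
  by apply: cvg_comp F0 _; exact: continuous_numField_horner.
have cP : (P.[e] : R[i]^o) @[e --> F] --> (P.[0] : R[i]^o).
  by apply: cvg_comp F0 _; exact: continuous_numField_horner.
have cg : ((g (complex.Re P.[e]))%:C : R[i]^o) @[e --> F] --> ((derive1 h t)%:C : R[i]^o).
  apply/cvgrPdist_lt => eps eps0.
  have epsE : (complex.Re eps)%:C = eps by rewrite RRe_real// gtr0_real.
  have reps0 : 0 < complex.Re eps by rewrite -ltcR epsE.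
  have [r /= [r0 hr]] : exists r : R, 0 < r /\
      (forall y, t - r < y -> y < t + r ->
         `|h y - h t - derive1 h t * (y - t)| <= complex.Re eps / 2 * `|y - t|).
    near (0 : R)^'+ => r; exists r; split; first by near: r; exact: nbhs_right_gt.
    by near: r; apply: derivable_linear_approx => //; rewrite divr_gt0.
  have : \forall e \near F, `|P.[0] - P.[e]| < r%:C.
    by move/cvgrPdist_lt : cP; apply; rewrite ltcR.
  have : \forall e \near F, P.[e] \is Num.real.
    by rewrite near_withinE; near=> e.
  apply: filterS2 => e Pe; rewrite horner_coef0 P0 -{1}(RRe_real Pe).
  move: (complex.Re _) => y; rewrite -epsE -!rmorphB /= !normr_real_complex !ltcR.
  rewrite /g ltr_distlC => /andP[ty yt].
  have [_|yt0] := eqVneq y t; first by rewrite subrr normr0.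
  have yt1 : y - t != 0 by rewrite subr_eq0.
  apply: (@le_lt_trans _ _ (complex.Re eps / 2)); last by lra.
  rewrite -(@ler_pM2r _ `|y - t|) ?normr_gt0// -normrM mulrBl mulfVK// distrC.
  exact: hr.
have cM : ((g (complex.Re P.[e]))%:C * Q.[e] : R[i]^o) @[e --> F]
    --> ((derive1 h t)%:C * Q.[0] : R[i]^o) by exact: cvgM cg cQ.
rewrite Q0; apply: cvg_trans cM; apply: near_eq_cvg.
rewrite !near_withinE; near=> e => /= e0 Pe.
have := PQ e; rewrite -{1}(RRe_real Pe) addrC => /eqP; rewrite -subr_eq -rmorphB /=.
move: (complex.Re _) => y /eqP yE; rewrite /g.
(* When P(e) = t with [e] nonzero, Q(e) = 0 and both sides vanish. *)
have [yt|yt0] := eqVneq y t.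
  move: yE; rewrite yt !subrr => /esym/eqP; rewrite mulf_eq0 (negbTE e0) orbF.
  by move=> /eqP ->; rewrite mulr0 mul0r.
have yt1 : (y - t)%:C != 0 :> R[i] by rewrite eq_complex /= eqxx andbT subr_eq0.
apply: (mulIf e0); rewrite divfK// -mulrA -yE -rmorphM /= divfK// subr_eq0.
exact: yt0.
Unshelve. all: end_near. Qed.

(** This is the reciprocal of the constant in front of [Vintegral]. *)
Definition truncH_coef1 (R : realType) (rho delta gamma beta : R[i]) (p q : R) : R[i] :=
  cGamma beta * (pochhammer rho q / pochhammer delta p / cGamma (gamma + beta)).

Lemma complex_ReD (R : realType) (x y : R[i]) :
  complex.Re (x + y) = complex.Re x + complex.Re y.
Proof. by case: x => ? ?; case: y. Qed.

Lemma pochhammer0 (R : realType) (z : R[i]) : 0 < complex.Re z -> pochhammer z 0 = 1.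
Proof. by move=> z0; rewrite /pochhammer addr0 divff// cGamma_neq0. Qed.

Lemma pochhammer_neq0 (R : realType) (z : R[i]) (s : R) : 0 < complex.Re z -> 0 < s ->
  pochhammer z s != 0.
Proof.
move=> z0 s0; rewrite mulf_neq0 ?invr_eq0 ?cGamma_neq0// complex_ReD/=.
by rewrite addr_gt0.
Qed.

Lemma truncH_coef1_neq0 (R : realType) (rho delta gamma beta : R[i]) (p q : R) :
    0 < complex.Re gamma -> 0 < complex.Re beta -> 0 < complex.Re rho ->
    0 < complex.Re delta -> 0 < p -> 0 < q ->
  truncH_coef1 rho delta gamma beta p q != 0.
Proof.
move=> ? ? ? ? ? ?.
by rewrite !mulf_neq0 ?invr_eq0 ?pochhammer_neq0 ?cGamma_neq0// complex_ReD addr_gt0.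
Qed.

(** As a function of the increment, [Vpoint] is a polynomial with constant term [t], so the chain
    rule above applies and its linear coefficient appears. *)
Lemma VderivE (R : realType) (rho delta gamma beta : R[i]) (p q : R)
    (i : nat) (alpha t : R) (h : R -> R) :
    0 < complex.Re gamma -> 0 < complex.Re beta -> 0 < complex.Re rho ->
    0 < complex.Re delta -> 0 < p -> 0 < q ->
    (0 < i)%N -> 0 < t -> derivable h t 1 ->
  Vderiv rho delta gamma beta p q i alpha h t =
  (derive1 h t)%:C * ((t `^ (1 - alpha))%:C * truncH_coef1 rho delta gamma beta p q).
Proof.
move=> ? ? ? ? ? ? i0 t0 dh; pose k : R[i] := (t `^ (- alpha))%:C.
pose P := \poly_(j < i.+1) (t%:C * (cGamma beta *
  (pochhammer rho (q * j%:R) / pochhammer delta (p * j%:R) /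
   cGamma (gamma * j%:R + beta))) * k ^+ j).
have PE : Vpoint rho delta gamma beta p q i alpha t = horner P.
  apply/funext => e; rewrite horner_poly /Vpoint /truncH big_mkord !mulr_sumr.
  by apply: eq_bigr => j _; rewrite exprMn; ring.
have P0 : P`_0 = t%:C.
  rewrite coef_poly /= !mulr0 add0r !pochhammer0// divr1 mulr1 mul1r.
  by rewrite divff ?cGamma_neq0// mulr1.
have P1 : P`_1 = (t `^ (1 - alpha))%:C * truncH_coef1 rho delta gamma beta p q.
  rewrite coef_poly ltnS i0 !mulr1 expr1 mulrAC /k -rmorphM /=; congr (_%:C * _).
  by rewrite powRD ?powRr1 ?(ltW t0)// (gt_eqF t0) implybT.
have t1 : (t `^ (1 - alpha))%:C != 0 :> R[i].
  by rewrite eq_complex /= eqxx andbT gt_eqF// powR_gt0.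
have sP : (1 < size P)%N.
  rewrite ltnNge; apply/negP => sP; have : P`_1 = 0 by rewrite nth_default.
  by rewrite P1; apply/eqP; rewrite mulf_neq0// truncH_coef1_neq0.
rewrite /Vderiv PE -P1; apply: (@cvg_lim _ _ _ _ _ _ _ (cvg_real_valued_quotient P0 dh)).
  exact: norm_hausdorff.
(* Uniqueness of the limit requires a proper filter: nonzero increments with real values must exist
   arbitrarily close to 0. *)
split; last by apply: within_filter.
move=> /nbhs_ballP [e /= e0 he].
have [z [z0 ze Pz]] := exists_small_real_value P0 sP e0.
by apply: (he z) => //; rewrite /ball /= sub0r normrN.
Qed.

(** * The V-integral of the V-derivative *)

Unset Implicit Arguments.

Theorem theorem12 (R : realType) (rho delta gamma beta : R[i]) (p q : R)
    (alpha : R) (i : nat) (a b : R) (f : R -> R)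
    (hgamma : 0 < complex.Re gamma) (hbeta : 0 < complex.Re beta)
    (hrho : 0 < complex.Re rho) (hdelta : 0 < complex.Re delta)
    (hp : 0 < p) (hq : 0 < q) (hpq : q <= complex.Re gamma + p)
    (hi : (0 < i)%N)
    (halpha0 : 0 < alpha) (halpha1 : alpha <= 1)
    (ha : 0 <= a)
    (hf : forall x : R, a < x < b -> derivable f x 1)
    (hfa : f x @[x --> a^'+] --> f a)
    (t : R) (hat : a < t) (htb : t < b)
    (hint : cintegrable `]a, t]
      (Vintegrand alpha (Vderiv rho delta gamma beta p q i alpha f))) :
  Vintegral rho delta gamma beta p q alpha a
    (Vderiv rho delta gamma beta p q i alpha f) t = (f t - f a)%:C.
Proof.
pose c := truncH_coef1 rho delta gamma beta p q.
have c0 : c != 0 by exact: truncH_coef1_neq0.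
have df x : a < x <= t -> derivable f x 1.
  by move=> /andP[ax xt]; apply: hf; rewrite ax (le_lt_trans xt).
(* The factor [x ^ (1 - alpha)] of the V-derivative cancels the weight of the integral, where [x] is
   positive because [0 <= a < x]. *)
have VE x : a < x <= t ->
    Vintegrand alpha (Vderiv rho delta gamma beta p q i alpha f) x = (derive1 f x)%:C * c.
  move=> axt; have /andP[ax _] := axt; have x0 : 0 < x by exact: le_lt_trans ax.
  rewrite /Vintegrand VderivE//; last exact: df.
  have x1 : (x `^ (1 - alpha))%:C != 0 :> R[i].
    by rewrite eq_complex /= eqxx andbT gt_eqF// powR_gt0.
  by rewrite -/c mulrCA mulrC mulKf.
have VRe x : a < x <= t ->
    complex.Re (Vintegrand alpha (Vderiv rho delta gamma beta p q i alpha f) x) =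
    complex.Re c * derive1 f x.
  by move=> /VE ->; case: (c) => ? ? /=; rewrite mul0r subr0 mulrC.
have VIm x : a < x <= t ->
    complex.Im (Vintegrand alpha (Vderiv rho delta gamma beta p q i alpha f) x) =
    complex.Im c * derive1 f x.
  by move=> /VE ->; case: (c) => ? ? /=; rewrite mul0r addr0 mulrC.
have [hRe hIm] := hint.
have iRe : lebesgue_measure.-integrable `]a, t] (EFin \o (fun x => complex.Re c * derive1 f x)).
  apply: eq_integrable hRe => //= x; rewrite inE/= in_itv/= => /VRe -> //.
have iIm : lebesgue_measure.-integrable `]a, t] (EFin \o (fun x => complex.Im c * derive1 f x)).
  apply: eq_integrable hIm => //= x; rewrite inE/= in_itv/= => /VIm -> //.
have scale (r : R) : r != 0 ->
    lebesgue_measure.-integrable `]a, t] (EFin \o (fun x => r * derive1 f x)) ->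
    lebesgue_measure.-integrable `]a, t] (EFin \o derive1 f).
  move=> r0 ir.
  have ir' : lebesgue_measure.-integrable `]a, t] (EFin \o (fun x => r^-1 * (r * derive1 f x))).
    exact: integrableZl ir.
  by apply: eq_integrable ir' => //= x _; rewrite mulKf.
(* As [c] is nonzero, its real or its imaginary part is nonzero. The corresponding part of the
   integrand, divided by it, is [f']. *)
have ig : lebesgue_measure.-integrable `]a, t] (EFin \o derive1 f).
  have [Re0|Re0] := eqVneq (complex.Re c) 0; last exact: scale iRe.
  apply: scale iIm; apply: contra_neq c0 => Im0.
  by rewrite [c]complexE Re0 Im0 mulr0 addr0.
have FTC := derivable_FTC_oc hat df hfa ig.
have -> : (f t - f a)%:C = c^-1 * ((f t - f a)%:C * c) by rewrite mulrCA mulVf ?mulr1.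
rewrite /Vintegral; congr (_ * _).
  rewrite /c /truncH_coef1.
  move: (cGamma (gamma + beta)) (pochhammer delta p) (cGamma beta) (pochhammer rho q) => A D B C.
  by rewrite !invfM !invrK; ring.
rewrite /cintegral; set I1 := Rintegral _ _ _; set I2 := Rintegral _ _ _.
have -> : I1 = complex.Re c * (f t - f a).
  rewrite -FTC -RintegralZl//; apply: eq_Rintegral => x.
  by rewrite inE/= in_itv/= => /VRe ->.
have -> : I2 = complex.Im c * (f t - f a).
  rewrite -FTC -RintegralZl//; apply: eq_Rintegral => x.
  by rewrite inE/= in_itv/= => /VIm ->.
by case: (c) => u v; apply/eqP; rewrite eq_complex /= !mul0r subr0 addr0 !(mulrC (f t - f a)) !eqxx.
Qed.
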